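(* Let $U$ be a supertropical semiring and $x\in\mathcal T(U)$. The following are equivalent. (i) The MFCE-relation $\mathrm T(x)$ is tangible. (ii) For every son $z$ of $x$ in $U$ the element $[z]_{\mathrm T(x)}$ is tangible in $U/\mathrm T(x)$ (and hence a tyrant). (iii) If $u,v,w\in U$ and $evx=ewx$, $uvx\in\mathcal T(U)$, $wx\in\mathcal T(U)$, then $uwx\in\mathcal T(U)$.
   Context: A supertropical semiring is a commutative semiring $U$ such that $e:=1+1$ is idempotent ($e+e=e$) and, for all $a,b\in U$, $a+b\in\{a,b\}$ if $ea\ne eb$, and $a+b=ea$ if $ea=eb$. (Then $ea=0\Rightarrow a=0$.) $M:=eU$ is the set of ghosts and $\mathcal T(U):=U\setminus eU$ the set of tangible elements. An MFCE-relation on $U$ is an equivalence relation $E$ with $x\sim_Ey\Rightarrow xz\sim_Eyz$ for all $z\in U$, and $x\sim_Ey\Rightarrow ex=ey$. $U/E$ carries the induced structure, with ghosts $e(U/E)=\{[a]_E\mid a\in M\}$ identified with $M$, and $\mathcal T(U/E)$ is the complement of the set of ghosts. $E$ is tangible if $[y]_E\in\mathcal T(U/E)\cup\{0\}$ for every $y\in\mathcal T(U)$. For $x\in\mathcal T(U)$, the set of sons of $x$ is $\mathrm S(x):=(Ux)\cap\mathcal T(U)$; a son of $x$ over $c\in M$ is a son $z$ with $ez=c$. $x$ is a tyrant if for every $c\in M$ it has at most one son over $c$ (same definitions in $U/E$). $\mathrm T(x)$ is the finest MFCE-relation $E$ on $U$ such that $s\sim_Et$ for all $s,t\in\mathrm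 S(x)$ with $es=et$. *)

(* Defs.v *)
From HB Require Import structures.
From mathcomp Require Import all_boot all_algebra.
From mathcomp Require Import boolp classical_sets.

Set Implicit Arguments.
Unset Strict Implicit.
Unset Printing Implicit Defensive.

Import GRing.Theory.
Local Open Scope classical_set_scope.
Local Open Scope quotient_scope.
Local Open Scope ring_scope.

Definition ghost1 {U : comPzSemiRingType} : U := 1 + 1.

HB.mixin Record isSupertropical U of GRing.ComPzSemiRing U := {
  ghost1_idem : ghost1 + ghost1 = ghost1 :> U;
  addr_ghost_neq : forall a b : U,
    ghost1 * a <> ghost1 * b -> a + b = a \/ a + b = b;
  addr_ghost_eq : forall a b : U,
    ghost1 * a = ghost1 * b -> a + b = ghost1 * a
}.

#[short(type="supertropicalType")]
HB.structure Definition Supertropical :=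
  {U of GRing.ComPzSemiRing U & isSupertropical U}.

Section Elements.
Variable U : supertropicalType.

Definition ghosts : set U := range (fun a : U => ghost1 * a).

Definition tangibles : set U := ~` ghosts.

Definition sons (x : U) : set U := range (fun u : U => u * x) `&` tangibles.

Definition sons_over (x c : U) : set U := [set z | sons x z /\ ghost1 * z = c].

Definition tyrant (x : U) : Prop :=
  tangibles x /\
  forall c, ghosts c ->
    forall y z, sons_over x c y -> sons_over x c z -> y = z.

End Elements.

Arguments ghosts {U}.
Arguments tangibles {U}.

(* Multiplicative, fibre-conserving equivalence relations.  A boolean [rel]   *)
(* is no restriction here: [asbool] turns any Prop-valued relation into one.  *)
Record is_mfce (U : supertropicalType) (E : rel U) : Prop := IsMfce {
  is_mfce_refl : reflexive E;
  is_mfce_sym : symmetric E;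
  is_mfce_trans : transitive E;
  is_mfce_mul : forall x y z : U, E x y -> E (x * z) (y * z);
  is_mfce_fibre : forall x y : U, E x y -> ghost1 * x = ghost1 * y
}.

Record mfce (U : supertropicalType) := Mfce {
  mfce_rel :> rel U;
  mfceP : is_mfce mfce_rel
}.

Section QuotientType.
Variables (U : supertropicalType) (E : mfce U).

Definition mfce_equiv : equiv_rel U :=
  EquivRel (mfce_rel E) (is_mfce_refl (mfceP E)) (is_mfce_sym (mfceP E))
    (is_mfce_trans (mfceP E)).

Definition mfce_quot : Type := {eq_quot mfce_equiv}.

HB.instance Definition _ := Choice.on mfce_quot.
HB.instance Definition _ := EqQuotient.on mfce_quot.

Definition mfce_class (a : U) : mfce_quot := \pi_mfce_quot a.

Lemma mfce_classP (a b : U) : mfce_class a = mfce_class b <-> E a b.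
Proof.
split=> [/eqP|Eab]; first by rewrite /mfce_class piE.
by apply/eqP; rewrite /mfce_class piE.
Qed.

Lemma mfce_class_repr (p : mfce_quot) : mfce_class (repr p) = p.
Proof. exact: reprK. Qed.

(* The multiplicative axiom and fibre conservation already force             *)
(* compatibility with addition, so that the operations of U descend to U/E.  *)
Lemma mfce_addr (x y z : U) : E x y -> E (x + z) (y + z).
Proof.
move=> Exy; have exy := is_mfce_fibre (mfceP E) Exy.
have Er := is_mfce_refl (mfceP E).
have [xz|xz] := pselect (ghost1 * x = ghost1 * z).
  by rewrite !addr_ghost_eq -?exy.
have yz : ghost1 * y <> ghost1 * z by rewrite -exy.
have [ex|ex] := addr_ghost_neq _ _ xz; have [ey|ey] := addr_ghost_neq _ _ yz;
  rewrite ex ey //.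
- by case: xz; rewrite -{1}ex -{2}ey !mulrDr exy.
- by case: xz; rewrite -{1}ex mulrDr exy -mulrDr ey.
Qed.

Lemma mfce_add (x x' y y' : U) : E x x' -> E y y' -> E (x + y) (x' + y').
Proof.
move=> Ex Ey; apply: (is_mfce_trans (mfceP E) (mfce_addr y Ex)).
by rewrite ![x' + _]addrC; apply: mfce_addr.
Qed.

Lemma mfce_mul (x x' y y' : U) : E x x' -> E y y' -> E (x * y) (x' * y').
Proof.
move=> Ex Ey; apply: (is_mfce_trans (mfceP E) (is_mfce_mul (mfceP E) y Ex)).
by rewrite ![x' * _]mulrC; apply: (is_mfce_mul (mfceP E)).
Qed.

Definition mfce_quot_add (p q : mfce_quot) : mfce_quot :=
  mfce_class (repr p + repr q).

Definition mfce_quot_mul (p q : mfce_quot) : mfce_quot :=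
  mfce_class (repr p * repr q).

Lemma mfce_reprE (a : U) : E (repr (mfce_class a)) a.
Proof. by apply/mfce_classP; rewrite mfce_class_repr. Qed.

Lemma mfce_quot_addE (a b : U) :
  mfce_quot_add (mfce_class a) (mfce_class b) = mfce_class (a + b).
Proof. by apply/mfce_classP/mfce_add; apply: mfce_reprE. Qed.

Lemma mfce_quot_mulE (a b : U) :
  mfce_quot_mul (mfce_class a) (mfce_class b) = mfce_class (a * b).
Proof. by apply/mfce_classP/mfce_mul; apply: mfce_reprE. Qed.

Lemma mfce_quotW (P : mfce_quot -> Prop) :
  (forall a, P (mfce_class a)) -> forall p, P p.
Proof. by move=> Pa p; rewrite -[p]mfce_class_repr. Qed.

Fact mfce_quot_addA : associative mfce_quot_add.
Proof.
by elim/mfce_quotW=> a; elim/mfce_quotW=> b; elim/mfce_quotW=> c;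
  rewrite !mfce_quot_addE addrA.
Qed.

Fact mfce_quot_addC : commutative mfce_quot_add.
Proof.
by elim/mfce_quotW=> a; elim/mfce_quotW=> b; rewrite !mfce_quot_addE addrC.
Qed.

Fact mfce_quot_add0 : left_id (mfce_class 0) mfce_quot_add.
Proof. by elim/mfce_quotW=> a; rewrite mfce_quot_addE add0r. Qed.

HB.instance Definition _ :=
  GRing.isNmodule.Build mfce_quot mfce_quot_addA mfce_quot_addC mfce_quot_add0.

Fact mfce_quot_mulA : associative mfce_quot_mul.
Proof.
by elim/mfce_quotW=> a; elim/mfce_quotW=> b; elim/mfce_quotW=> c;
  rewrite !mfce_quot_mulE mulrA.
Qed.

Fact mfce_quot_mulC : commutative mfce_quot_mul.
Proof.
by elim/mfce_quotW=> a; elim/mfce_quotW=> b; rewrite !mfce_quot_mulE mulrC.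
Qed.

Fact mfce_quot_mul1 : left_id (mfce_class 1) mfce_quot_mul.
Proof. by elim/mfce_quotW=> a; rewrite mfce_quot_mulE mul1r. Qed.

Fact mfce_quot_mulDl : left_distributive mfce_quot_mul mfce_quot_add.
Proof.
by elim/mfce_quotW=> a; elim/mfce_quotW=> b; elim/mfce_quotW=> c;
  rewrite !(mfce_quot_addE, mfce_quot_mulE) mulrDl.
Qed.

Fact mfce_quot_mul0 : left_zero (mfce_class 0) mfce_quot_mul.
Proof. by elim/mfce_quotW=> a; rewrite mfce_quot_mulE mul0r. Qed.

HB.instance Definition _ :=
  GRing.Nmodule_isComPzSemiRing.Build mfce_quot
    mfce_quot_mulA mfce_quot_mulC mfce_quot_mul1 mfce_quot_mulDl mfce_quot_mul0.

Lemma mfce_classD (a b : U) : mfce_class (a + b) = mfce_class a + mfce_class b.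
Proof. by rewrite -mfce_quot_addE. Qed.

Lemma mfce_classM (a b : U) : mfce_class (a * b) = mfce_class a * mfce_class b.
Proof. by rewrite -mfce_quot_mulE. Qed.

Lemma mfce_class0 : mfce_class 0 = 0. Proof. by []. Qed.

Lemma mfce_class1 : mfce_class 1 = 1. Proof. by []. Qed.

Lemma mfce_class_ghost1 : mfce_class ghost1 = ghost1.
Proof. by rewrite mfce_classD. Qed.

Fact mfce_quot_ghost1_idem : ghost1 + ghost1 = ghost1 :> mfce_quot.
Proof. by rewrite -mfce_class_ghost1 -mfce_classD ghost1_idem. Qed.

Fact mfce_quot_addr_ghost_neq (p q : mfce_quot) :
  ghost1 * p <> ghost1 * q -> p + q = p \/ p + q = q.
Proof.
elim/mfce_quotW: p => a; elim/mfce_quotW: q => b.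
rewrite -mfce_class_ghost1 -!mfce_classM -mfce_classD => neq.
have /addr_ghost_neq : ghost1 * a <> ghost1 * b by move=> eab; rewrite eab in neq.
by case=> ->; [left | right].
Qed.

Fact mfce_quot_addr_ghost_eq (p q : mfce_quot) :
  ghost1 * p = ghost1 * q -> p + q = ghost1 * p.
Proof.
elim/mfce_quotW: p => a; elim/mfce_quotW: q => b.
rewrite -mfce_class_ghost1 -!mfce_classM -mfce_classD => /mfce_classP Eab.
congr mfce_class; apply: addr_ghost_eq.
have idem (c : U) : ghost1 * (ghost1 * c) = ghost1 * c.
  by rewrite mulrA {1}/ghost1 mulrDl mul1r ghost1_idem.
by have := is_mfce_fibre (mfceP E) Eab; rewrite !idem.
Qed.

HB.instance Definition _ :=
  isSupertropical.Build mfce_quot mfce_quot_ghost1_idem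
    mfce_quot_addr_ghost_neq mfce_quot_addr_ghost_eq.

(* Justifies calling the ghosts of U/E "identified" with those of U. *)
Lemma ghosts_mfce_quot :
  ghosts = mfce_class @` ghosts /\ {in ghosts &, injective mfce_class}.
Proof.
have idem (c : U) : ghost1 * (ghost1 * c) = ghost1 * c.
  by rewrite mulrA {1}/ghost1 mulrDl mul1r ghost1_idem.
split.
- apply/seteqP; split=> [_ [p _ <-]|_ [_ [a _ <-] <-]].
    elim/mfce_quotW: p => a; exists (ghost1 * a); first by exists a.
    by rewrite mfce_classM mfce_class_ghost1.
  by exists (mfce_class a) => //; rewrite -mfce_class_ghost1 -mfce_classM.
- move=> _ _ /set_mem[a _ <-] /set_mem[b _ <-] /mfce_classP.
  by move/(is_mfce_fibre (mfceP E)); rewrite !idem.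
Qed.

Definition mfce_tangible : Prop :=
  forall y : U, tangibles y -> (tangibles `|` [set 0]) (mfce_class y).

End QuotientType.

Section SonRelation.
Variables (U : supertropicalType) (x : U).

Definition identifies_sons (E : rel U) : Prop :=
  forall s t : U, sons x s -> sons x t -> ghost1 * s = ghost1 * t -> E s t.

(* The intersection of all the MFCE-relations in question; [T_rel_mfce],     *)
(* [T_rel_identifies] and [T_rel_finest] show that it is the finest one.     *)
Definition T_rel : rel U := fun a b =>
  `[< forall E : rel U, is_mfce E -> identifies_sons E -> E a b >].

Lemma T_rel_mfce : is_mfce T_rel.
Proof.
split.
- by move=> a; apply/asboolP => E mE _; apply: is_mfce_refl mE a.
- move=> a b; apply/asboolP/asboolP => ab E mE sE;
  by rewrite (is_mfce_sym mE); apply: ab.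
- move=> b a c /asboolP ab /asboolP bc; apply/asboolP => E mE sE.
  exact: is_mfce_trans mE _ _ _ (ab E mE sE) (bc E mE sE).
- move=> a b c /asboolP ab; apply/asboolP => E mE sE.
  exact: is_mfce_mul mE _ _ _ (ab E mE sE).
- move=> a b /asboolP /(_ (fun a b => ghost1 * a == ghost1 * b)) ab.
  apply/eqP/ab; last by move=> s t _ _ ->.
  split=> [c|c d|c d f /eqP-> /eqP->|c d f /eqP cd|c d /eqP] //.
  by rewrite !mulrA cd.
Qed.

Definition T : mfce U := Mfce T_rel_mfce.

Lemma T_rel_identifies : identifies_sons T.
Proof. by move=> s t xs xt st; apply/asboolP => E _; apply. Qed.

Lemma T_rel_finest (E : mfce U) :
  identifies_sons E -> forall a b, T a b -> E a b.
Proof. by move=> sE a b /asboolP; apply=> //; apply: mfceP. Qed.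

End SonRelation.

(* Main.v *)
Require Import Defs.
From mathcomp Require Import all_boot all_algebra.
From mathcomp Require Import boolp classical_sets.
Local Open Scope ring_scope.

(** Under (iii), multiplication by [u] maps two sons of [x] with the same ghost
    companion either to two sons or to two equal ghosts.  Hence [T x] merely
    identifies sons over the same ghost and is the identity elsewhere, so that
    it never relates a tangible element to a ghost. *)

Set Implicit Arguments.
Unset Strict Implicit.
Unset Printing Implicit Defensive.

Import GRing.Theory.

Section Ghosts.
Variable U : supertropicalType.
Implicit Types a b c : U.

Lemma ghost1M a : ghost1 * (ghost1 * a) = ghost1 * a.
Proof. by rewrite mulrA {1}/ghost1 mulrDl mul1r ghost1_idem. Qed.

(** Here [a] and [0] have the same ghost companion, so [a = a + 0 = ghost1 * a = 0]. *)
Lemma ghost1_eq0 a : ghost1 * a = 0 -> a = 0.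
Proof.
move=> ea0; have := @addr_ghost_eq U a 0.
by rewrite mulr0 addr0 ea0; apply.
Qed.

Lemma ghostsE a : ghosts a <-> ghost1 * a = a.
Proof. by split=> [[b _ <-]|<-]; [exact: ghost1M | exists a]. Qed.

Lemma ghosts0 : ghosts (0 : U).
Proof. by apply/ghostsE; rewrite mulr0. Qed.

Lemma ghostsM c a : ghosts a -> ghosts (c * a).
Proof. by move=> [b _ <-]; exists (c * b); rewrite // mulrCA. Qed.

Lemma tangiblesM c a : tangibles (c * a) -> tangibles a.
Proof. by move=> tca /(ghostsM c). Qed.

Lemma sonsM c x : tangibles (c * x) -> sons x (c * x).
Proof. by split=> //; exists c. Qed.

End Ghosts.

Section Quotient.
Variables (U : supertropicalType) (E : mfce U).
Implicit Types a b : U.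

Lemma ghosts_mfce_class a : ghosts a -> ghosts (mfce_class E a).
Proof.
by move/ghostsE=> ea; apply/ghostsE; rewrite -mfce_class_ghost1 -mfce_classM ea.
Qed.

Lemma mfce_class_ghosts a : ghosts (mfce_class E a) -> E a (ghost1 * a).
Proof.
move/ghostsE=> ea; apply/mfce_classP.
by rewrite mfce_classM mfce_class_ghost1 ea.
Qed.

Lemma mfce_class_ghost_eq a b :
  ghost1 * mfce_class E a = ghost1 * mfce_class E b -> ghost1 * a = ghost1 * b.
Proof.
rewrite -mfce_class_ghost1 -!mfce_classM => /mfce_classP.
by move/(is_mfce_fibre (mfceP E)); rewrite !ghost1M.
Qed.

Lemma mfce_class_eq0 a : mfce_class E a = 0 -> a = 0.
Proof.
rewrite -mfce_class0 => /mfce_classP /(is_mfce_fibre (mfceP E)).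
by rewrite mulr0 => /ghost1_eq0.
Qed.

End Quotient.

(** Sons of the class of [z] lift to multiples of [x] in [U]. The lifts are tangible, since ghosts
    have ghost classes, and lie over the same ghost; so [T x] identifies them. *)
Lemma tyrant_mfce_class_T (U : supertropicalType) (x z : U) :
  sons x z -> tangibles (mfce_class (T x) z) -> tyrant (mfce_class (T x) z).
Proof.
move=> [[k _ <-] _] tz; split=> // c _ _ _ [[[p _ <-] tp] ep] [[[q _ <-] tq] eq].
elim/mfce_quotW: p => a in tp ep *; elim/mfce_quotW: q => b in tq eq *.
rewrite -!mfce_classM !mulrA in tp tq *.
apply/mfce_classP/T_rel_identifies.
- by apply: sonsM => /(ghosts_mfce_class (T x)).
- by apply: sonsM => /(ghosts_mfce_class (T x)).
- apply: (mfce_class_ghost_eq (E := T x)).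
  by rewrite -!mulrA (mfce_classM _ a) (mfce_classM _ b) ep eq.
Qed.

Section SonEquivalence.
Variables (U : supertropicalType) (x : U).

(** Explicit candidate for [T x]; only its compatibility with multiplication needs condition
    (iii). *)
Definition same_son : rel U := fun a b =>
  `[< a = b \/ [/\ sons x a, sons x b & ghost1 * a = ghost1 * b] >].

Hypothesis tangible_transfer : forall u v w : U,
  ghost1 * v * x = ghost1 * w * x ->
  tangibles (u * v * x) -> tangibles (w * x) -> tangibles (u * w * x).

Lemma tangible_mul_sons (s t u : U) :
  sons x s -> sons x t -> ghost1 * s = ghost1 * t ->
  tangibles (u * s) -> tangibles (u * t).
Proof.
move=> [[v _ <-] _] [[w _ <-] tw]; rewrite !mulrA => evw tuv.
exact: tangible_transfer evw tuv tw.
Qed.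

Lemma same_son_mfce : is_mfce same_son.
Proof.
split.
- by move=> a; apply/asboolP; left.
- by move=> a b; apply/asboolP/asboolP=> -[->|[sa sb eab]]; by [left | right].
- move=> b a c /asboolP[->//|[sa sb eab]] /asboolP[<-|[_ sc ebc]].
    by apply/asboolP; right.
  by apply/asboolP; right; split=> //; rewrite eab.
- move=> s t u /asboolP[->|[ss st est]]; apply/asboolP; first by left.
  have eu : ghost1 * (u * s) = ghost1 * (u * t) by rewrite !(mulrCA _ u) est.
  rewrite ![_ * u]mulrC.
  (* Two ghost products coincide, as each is its own ghost companion; [tangible_mul_sons] excludes
     the mixed cases; two tangible products are again sons of [x]. *)
  have [gs|tus] := pselect (ghosts (u * s)).
    have [gt|tut] := pselect (ghosts (u * t)).
      by left; rewrite -((ghostsE _).1 gs) eu ((ghostsE _).1 gt).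
    by case: (tangible_mul_sons st ss (esym est) tut).
  have tut := tangible_mul_sons ss st est tus.
  right; split=> //.
    by case: ss tus => -[v _ <-] _; rewrite mulrA; apply: sonsM.
  by case: st tut => -[w _ <-] _; rewrite mulrA; apply: sonsM.
- by move=> a b /asboolP[->|[]].
Qed.

Lemma T_same_son a b : T x a b -> same_son a b.
Proof.
apply: (@T_rel_finest U x (Mfce same_son_mfce)) => s t ss st est.
by apply/asboolP; right.
Qed.

Lemma T_tangible : mfce_tangible (T x).
Proof.
(* If the class of [y] were a ghost, [y] would be related to [ghost1 * y]: either they are equal and
   [y] is a ghost, or the ghost [ghost1 * y] is a son, hence tangible. *)
move=> y ty; left=> /mfce_class_ghosts /T_same_son /asboolP[yey|[_ [_ tey] _]].
  by apply: ty; apply/ghostsE.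
by apply: tey; exists y.
Qed.

End SonEquivalence.

Theorem theorem7p6 (U : supertropicalType) (x : U) (hx : tangibles x) :
  [<-> mfce_tangible (T x);
       forall z : U, sons x z -> tangibles (mfce_class (T x) z);
       forall u v w : U, ghost1 * v * x = ghost1 * w * x ->
         tangibles (u * v * x) -> tangibles (w * x) -> tangibles (u * w * x)]
  /\ (forall z : U, sons x z ->
        tangibles (mfce_class (T x) z) -> tyrant (mfce_class (T x) z)).
Proof.
split; last exact: tyrant_mfce_class_T.
tfae=> [tT z [_ tz]|tsons u v w evw tuv tw guw|]; last exact: T_tangible.
(* Only the zero class has to be excluded, and it contains nothing but the ghost [0]. *)
- have [//|/mfce_class_eq0 z0] := tT z tz.
  by case: tz; rewrite z0; apply: ghosts0.
(* Both [v * x] and [w * x] are sons over one ghost, so multiplying by [u] gives [u * v * x] and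
   [u * w * x] the same class. Were [u * w * x] a ghost, the son [u * v * x] would have a ghost
   class. *)
- have tv : tangibles (v * x) by move: tuv; rewrite -mulrA => /tangiblesM.
  have Tvw : T x (v * x) (w * x).
    by apply: T_rel_identifies; rewrite ?mulrA //; apply: sonsM.
  have : mfce_class (T x) (u * v * x) = mfce_class (T x) (u * w * x).
    apply/mfce_classP; rewrite -!mulrA ![u * _]mulrC.
    exact: (is_mfce_mul (mfceP (T x)) u Tvw).
  move=> cvw; case: (tsons _ (sonsM tuv)).
  by rewrite cvw; apply: ghosts_mfce_class.
Qed.
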